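(* Let $p$ be a non-negative integer. Let $G$ be a graph and let $G^{(p)}$ be its $p$-subdivision. Then \[\chi(G)^{\frac{1}{p+1}}\leq \chi_{p+1}(G^{(p)})\leq \max(\chi(G),p+2).\]
   Context: All graphs are finite, simple and undirected. The $p$-subdivision $G^{(p)}$ of $G$ is obtained by subdividing each edge by exactly $p$ vertices, i.e. replacing each edge by a path of length $p+1$. $\chi(G)$ is the chromatic number. The tree-depth ${\rm td}(G)$ is the minimum height (number of vertices on a longest root-to-leaf path) of a rooted forest $Y$ such that $G$ is a subgraph of the closure of $Y$ (the graph in which each vertex is adjacent to all its ancestors in $Y$). For a positive integer $q$, $\chi_q(G)$ is the minimum number of colors in a vertex coloring of $G$ such that every set $I$ of at most $q$ colors induces a subgraph of tree-depth at most $|I|$. *)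

(* Defs.v *)
From mathcomp Require Import boolp reals exp.
From mathcomp Require Import all_boot all_order all_algebra.

Set Implicit Arguments.
Unset Strict Implicit.
Unset Printing Implicit Defensive.

Record sgraph := SGraph {
  svertex :> finType;
  adj : rel svertex;
  adj_sym : symmetric adj;
  adj_irrefl : irreflexive adj
}.

Section Induced.
Variables (G : sgraph) (A : {set G}).

Definition induced_adj : rel {x : G | x \in A} :=
  fun x y => adj (val x) (val y).

Lemma induced_adj_sym : symmetric induced_adj.
Proof. by move=> x y; apply: adj_sym. Qed.

Lemma induced_adj_irrefl : irreflexive induced_adj.
Proof. by move=> x; apply: adj_irrefl. Qed.

Definition induced : sgraph := SGraph induced_adj_sym induced_adj_irrefl.

End Induced.

(* Subgraph containment up to isomorphism. *)
Definition is_subgraph (G H : sgraph) : Prop :=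
  exists2 f : G -> H, injective f & forall x y, adj x y -> adj (f x) (f y).

Definition colorable (G : sgraph) (k : nat) : bool :=
  [exists c : {ffun G -> 'I_k}, forall x, forall y, adj x y ==> (c x != c y)].

Lemma ex_colorable (G : sgraph) : exists k, colorable G k.
Proof.
exists #|G|; apply/existsP; exists [ffun x => enum_rank x].
apply/forallP=> x; apply/forallP=> y; apply/implyP=> xy; rewrite !ffunE.
by apply: contraTneq xy => /enum_rank_inj ->; rewrite adj_irrefl.
Qed.

Definition chromatic_number (G : sgraph) : nat := ex_minn (ex_colorable G).

Section Subdivision.
Variables (p : nat) (G : sgraph).

(* Each edge is listed once, as the pair of its ends in the order of the
   enumeration of the vertices; the orientation only serves to number the
   subdivision vertices along the edge. *)
Definition sedge : finType :=
  {xy : G * G | adj xy.1 xy.2 && (enum_rank xy.1 < enum_rank xy.2)}.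

Definition subdiv_vertex : finType := (G + sedge * 'I_p)%type.

(* The k-th vertex, 0 <= k <= p.+1, of the path replacing the edge [d]. *)
Definition path_vertex (d : sedge) (k : nat) : subdiv_vertex :=
  if k is k'.+1 then
    if insub k' is Some i then inr (d, i) else inl (val d).2
  else inl (val d).1.

Definition subdiv_adj : rel subdiv_vertex := fun u v =>
  [exists d : sedge, exists k : 'I_p.+1,
    ((u == path_vertex d k) && (v == path_vertex d k.+1)) ||
    ((v == path_vertex d k) && (u == path_vertex d k.+1))].

Lemma subdiv_adj_sym : symmetric subdiv_adj.
Proof.
by move=> u v; apply: eq_existsb => d; apply: eq_existsb => k; rewrite orbC.
Qed.

Lemma path_vertex_neq d (k : nat) :
  k < p.+1 -> path_vertex d k != path_vertex d k.+1.
Proof.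
case: k => [|k] kp /=.
  case: insubP => [//|_]; apply/eqP => -[E].
  by have := valP d; rewrite E ltnn andbF.
rewrite insubT //; case: insubP => [i _ E|//].
apply/eqP => -[E']; move: E; rewrite -E' /= => E.
by have := ltnn k; rewrite {2}E leqnn.
Qed.

Lemma subdiv_adj_irrefl : irreflexive subdiv_adj.
Proof.
move=> u; apply/negbTE/negP => /existsP[d /existsP[k]].
rewrite orbb => /andP[/eqP Ek /eqP Ek1].
by have := path_vertex_neq d (ltn_ord k); rewrite -Ek -Ek1 eqxx.
Qed.

Definition subdivision : sgraph := SGraph subdiv_adj_sym subdiv_adj_irrefl.

End Subdivision.

(* A rooted forest is given by its parent map, the roots having no parent;
   acyclicity says that climbing from any vertex leaves the forest. *)
Record rforest := RForest {
  fvertex :> finType;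
  parent : fvertex -> option fvertex;
  parent_acyclic : forall x, exists n, iter n (obind parent) (Some x) = None
}.

Section Forest.
Variable Y : rforest.

(* Reflexive: [ancestor x x] holds. *)
Definition ancestor (y x : Y) : bool :=
  connect (fun u v : Y => parent u == Some v) x y.

Definition closure_adj : rel Y :=
  fun x y => (x != y) && (ancestor x y || ancestor y x).

Lemma closure_adj_sym : symmetric closure_adj.
Proof. by move=> x y; rewrite /closure_adj eq_sym orbC. Qed.

Lemma closure_adj_irrefl : irreflexive closure_adj.
Proof. by move=> x; rewrite /closure_adj eqxx. Qed.

Definition closure : sgraph := SGraph closure_adj_sym closure_adj_irrefl.

Definition is_root (x : Y) : bool := parent x == None.

Definition is_leaf (x : Y) : bool := [forall y : Y, parent y != Some x].

Definition root_to_leaf_path (s : seq Y) : bool :=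
  if s is r :: s' then
    [&& is_root r, path (fun u v : Y => parent v == Some u) r s'
      & is_leaf (last r s')]
  else false.

(* By acyclicity the vertices of a path are distinct, so bounding the number
   of vertices by [#|Y|] excludes no path. *)
Definition height : nat :=
  \max_(n < #|Y|.+1 | [exists s : n.-tuple Y, root_to_leaf_path s]) n.

Lemma height_le_card : height <= #|Y|.
Proof. by apply/bigmax_leqP => n _; rewrite -ltnS. Qed.

End Forest.

Section PathForest.
Variable n : nat.

Definition pred_ord (i : 'I_n) : option 'I_n :=
  if val i is j.+1 then insub j else None.

Lemma pred_ord_acyclic i : exists m, iter m (obind pred_ord) (Some i) = None.
Proof.
case: i => k; elim: k => [|k IH] kn; first by exists 1.
have [m E] := IH (ltnW kn); exists m.+1.
by rewrite iterSr /= /pred_ord /= (insubT (fun j => j < n) (ltnW kn)).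
Qed.

Definition path_forest : rforest := RForest pred_ord_acyclic.

Lemma path_forest_ancestor (i j : path_forest) :
  nat_of_ord (i : 'I_n) <= nat_of_ord (j : 'I_n) -> ancestor i j.
Proof.
case: i j => i ilt [j jlt] /=; elim: j jlt => [|j IH] jlt.
  rewrite leqn0 => /eqP i0; subst i.
  by rewrite (bool_irrelevance jlt ilt); apply: connect0.
rewrite leq_eqVlt => /predU1P[E|le_ij].
  by subst i; rewrite (bool_irrelevance jlt ilt); apply: connect0.
apply: connect_trans (IH (ltnW jlt) le_ij); apply: connect1.
by rewrite /= /pred_ord /= (insubT (fun j => j < n) (ltnW jlt)).
Qed.

End PathForest.

Definition treedepth_witness (G : sgraph) (h : nat) : bool :=
  `[< exists2 Y : rforest, is_subgraph G (closure Y) & height Y = h >].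

Lemma path_forest_witness (G : sgraph) :
  treedepth_witness G (height (path_forest #|G|)).
Proof.
apply/asboolP; exists (path_forest #|G|) => //.
exists (@enum_rank G) => [|x y xy]; first exact: enum_rank_inj.
rewrite /= /closure_adj; apply/andP; split.
  by apply: contraTneq xy => /enum_rank_inj ->; rewrite adj_irrefl.
case/orP: (leq_total (enum_rank x) (enum_rank y)) => le_xy.
  by rewrite (path_forest_ancestor le_xy).
by rewrite (path_forest_ancestor le_xy) orbT.
Qed.

Lemma ex_treedepth (G : sgraph) : exists h, treedepth_witness G h.
Proof. by exists (height (path_forest #|G|)); apply: path_forest_witness. Qed.

Definition treedepth (G : sgraph) : nat := ex_minn (ex_treedepth G).

Lemma treedepth_le_card (G : sgraph) : treedepth G <= #|G|.
Proof.
rewrite /treedepth; case: ex_minnP => h _ /(_ _ (path_forest_witness G)) le_h.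
by apply: leq_trans le_h _; rewrite -{2}(card_ord #|G|); apply: height_le_card.
Qed.

Definition td_colorable (q : nat) (G : sgraph) (k : nat) : bool :=
  [exists c : {ffun G -> 'I_k}, forall I : {set 'I_k},
    (#|I| <= q) ==> (treedepth (induced [set x | c x \in I]) <= #|I|)].

Lemma ex_td_colorable (q : nat) (G : sgraph) : exists k, td_colorable q G k.
Proof.
exists #|G|; apply/existsP; exists [ffun x => enum_rank x].
apply/forallP=> I; apply/implyP=> _; apply: leq_trans (treedepth_le_card _) _.
rewrite card_sig -[leqLHS](card_imset _ (@enum_rank_inj G)).
apply: subset_leq_card.
by apply/subsetP => _ /imsetP[x xI ->]; move: xI; rewrite !inE ffunE.
Qed.

Definition chi_ (q : nat) (G : sgraph) : nat := ex_minn (ex_td_colorable q G).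

(* Main.v *)
Require Import Defs.
From mathcomp Require Import boolp reals exp.
From mathcomp Require Import all_boot all_order all_algebra.
From mathcomp Require Import zify.

(* Lower bound. Let [c] be a colouring of the subdivision with N colours as in
   the definition of chi_(p+1), and let i be a colour; we show that the
   subgraph of G induced by the original vertices of colour i has a proper
   colouring with N^p colours. Put q = min(N-1, p). The path of each of its
   edges uses only colours of some set I of q+1 colours containing i, and there
   are 'C(N-1, q) such sets. For fixed I, take a forest of height at most q+1
   whose closure contains the graph induced by I. Each path that replaces an
   edge has a vertex that is an ancestor of all its vertices (its top); charge
   the edge to an end below the top, together with the depth of the top. No two
   edges get the same charge. Since a path on p+2 vertices is not a star unless
   p <= 1, the top has depth less than q-1, except when p = q = 1. So the edges
   inside a set W of original vertices number at most (q-1)#|W| for each I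
   (#|W|/2 if p = q = 1), and the graph is (N^q - 1)-degenerate.

   Upper bound. Extend a proper colouring of G with max(chi(G), p+2) colours so
   that each path that replaces an edge is rainbow. A set I of at most p+1
   colours then contains no whole path, so it induces a union of spiders (the
   partial paths around an original vertex) and of paths interior to an edge.
   Rooting the spiders at their centres gives a forest whose branches are
   rainbow, of height at most #|I|. *)

Set Implicit Arguments.
Unset Strict Implicit.
Unset Printing Implicit Defensive.
Import GRing.Theory Num.Theory.

(** * Colourings and degeneracy *)

Lemma colorable_fin (G : sgraph) (T : finType) (f : G -> T) (k : nat) :
  (forall x y, adj x y -> f x != f y) -> #|T| <= k -> colorable G k.
Proof.
move=> fP Tk; apply/existsP; exists [ffun x => widen_ord Tk (enum_rank (f x))].
apply/forallP => x; apply/forallP => y; apply/implyP => /fP; rewrite !ffunE.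
by apply: contraNneq => /(congr1 val) /= /val_inj /enum_rank_inj ->.
Qed.

Lemma chromatic_number_le (G : sgraph) (k : nat) :
  colorable G k -> chromatic_number G <= k.
Proof. by rewrite /chromatic_number; case: ex_minnP => m _; apply. Qed.

(** Induction on [#|V|]: the at most [D] neighbours of [x] in [V] leave one of the [D.+1] colours
    free for [x]. *)
Lemma degenerate_colorable (G : sgraph) (D : nat) (V : {set G}) :
  (forall W : {set G}, W \subset V -> W != set0 ->
     exists2 x, x \in W & #|[set y in W | adj x y]| <= D) ->
  exists f : {ffun G -> 'I_D.+1}, {in V &, forall x y, adj x y -> f x != f y}.
Proof.
elim: {V}_.+1 {-2}V (ltnSn #|V|) => // n IH V; rewrite ltnS => Vn degV.
have [->|V0] := eqVneq V set0; first by exists [ffun=> ord0] => x y; rewrite inE.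
have [x xV degx] := degV V (subxx _) V0.
have [|W WV W0|f fP] := IH (V :\ x).
- by apply: leq_trans Vn; rewrite [X in _ < X](cardsD1 x) xV.
- by apply: degV W0; apply: subset_trans WV (subD1set _ _).
pose S := [set f y | y in [set y in V | adj x y]].
have /subsetPn [z _ zS] : ~~ ([set: 'I_D.+1] \subset S).
  apply/negP => /subset_leq_card; rewrite cardsT card_ord leqNgt ltnS.
  by rewrite (leq_trans (leq_imset_card _ _) degx).
exists [ffun y => if y == x then z else f y] => u v uV vV uv; rewrite !ffunE.
have zN y : y \in V -> adj x y -> f y != z.
  by move=> yV xy; apply: contraNneq zS => <-; apply: imset_f; rewrite inE yV.
have [ux|ux] := eqVneq u x; have [vx|vx] := eqVneq v x.
- by move: uv; rewrite ux vx adj_irrefl.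
- by rewrite eq_sym zN // -ux.
- by rewrite zN // -vx adj_sym.
- by apply: fP => //; rewrite !inE ?ux ?vx.
Qed.

(** * Depth and ancestry in rooted forests, and tree-depth in these terms *)

Section ForestOrder.
Variable Y : rforest.
Implicit Types x y z : Y.

Lemma ex_depth x : exists n, iter n (obind (@parent Y)) (Some x) == None.
Proof. by have [n E] := parent_acyclic x; exists n; apply/eqP. Qed.

(** The minimum counts the vertices up to the root, so [.-1] gives roots depth 0. *)
Definition depth x : nat := (ex_minn (ex_depth x)).-1.

Lemma depth_root x : parent x = None -> depth x = 0.
Proof.
move=> px; rewrite /depth; case: ex_minnP => n _ /(_ 1).
by rewrite /= px => /(_ isT); case: n => [|[]].
Qed.

Lemma depth_parent x y : parent x = Some y -> depth x = (depth y).+1.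
Proof.
move=> px; rewrite /depth; case: ex_minnP => n En nP; case: ex_minnP => m Em mP.
case: n En nP => // n; rewrite iterSr /= px => En nP.
have mn := mP _ En.
have := nP m.+1; rewrite iterSr /= px => /(_ Em); rewrite ltnS => nm.
have -> : n = m by apply/eqP; rewrite eqn_leq nm mn.
by case: m Em {mP mn nm}.
Qed.

Lemma ancestor_trans y x z : ancestor x y -> ancestor y z -> ancestor x z.
Proof. by move=> xy yz; apply: connect_trans yz xy. Qed.

Lemma ancestor_parent x y z : parent x = Some y ->
  ancestor z x -> z = x \/ ancestor z y.
Proof.
move=> px /connectP [[|u s] /=]; first by left.
by rewrite px => /andP[/eqP[<-] us] ->; right; apply/connectP; exists s.
Qed.

Lemma ancestor_root x z : parent x = None -> ancestor z x -> z = x.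
Proof. by move=> px /connectP [[|u s] //=]; rewrite px. Qed.

Lemma parent_ind (P : Y -> Prop) :
  (forall x, (forall y, parent x = Some y -> P y) -> P x) -> forall x, P x.
Proof.
move=> IH x; elim: {x}_.+1 {-2}x (ltnSn (depth x)) => // n IHn x xn.
by apply: IH => y /depth_parent E; apply: IHn; rewrite -E.
Qed.

Lemma ancestor_depth x y : ancestor y x -> y != x -> depth y < depth x.
Proof.
elim/parent_ind: x => x IH yx nyx.
case px: (parent x) => [z|]; last by rewrite (ancestor_root px yx) eqxx in nyx.
rewrite (depth_parent px) ltnS.
case: (ancestor_parent px yx) => [E|yz]; first by rewrite E eqxx in nyx.
by have [->//|nyz] := eqVneq y z; apply/ltnW/IH.
Qed.

Lemma ancestor_chain x y z :
  ancestor y x -> ancestor z x -> ancestor y z || ancestor z y.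
Proof.
elim/parent_ind: x => x IH yx zx.
case px: (parent x) => [u|]; last first.
  by rewrite (ancestor_root px yx) (ancestor_root px zx) /ancestor connect0.
case: (ancestor_parent px yx) => [->|yu]; first by rewrite zx orbT.
case: (ancestor_parent px zx) => [->|zu]; first by rewrite yx.
exact: IH px yu zu.
Qed.

Lemma root_path x : exists s, [/\ size s = (depth x).+1, last x s = x &
  if s is r :: s' then is_root r && path (fun u v => parent v == Some u) r s'
  else false].
Proof.
elim/parent_ind: x => x IH; case px: (parent x) => [y|]; last first.
  by exists [:: x]; rewrite /= (depth_root px) /is_root px.
have [[|r s] [ss sy] //] := IH _ px; move: ss sy => /= [ss] sy /andP[rr rs].
exists (r :: rcons s x); split; rewrite /= ?size_rcons ?last_rcons //.
  by rewrite ss (depth_parent px).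
by rewrite rr rcons_path rs sy px eqxx.
Qed.

(** A deepest vertex is a leaf, so the path from its root is among those that [height] measures. *)
Lemma depth_lt_height x : depth x < height Y.
Proof.
pose Q y := (depth x <= depth y).
pose y := [arg max_(y > x | Q y) depth y].
have [xy ymax] : Q y /\ (forall z, Q z -> depth z <= depth y).
  by rewrite /y; case: arg_maxnP => [|z Qz zmax //]; exact: leqnn.
have [[|r s] [ss sy] //] := root_path y; move=> /andP[rr rs].
have leaf : is_leaf y.
  apply/forallP => z; apply/eqP => /depth_parent E.
  by have := ymax z; rewrite /Q E leqW // ltnn => /(_ isT).
have dec : sorted ltn (map depth (r :: s)).
  rewrite /=; apply: (homo_path _ rs).
  by move=> u v /eqP /depth_parent ->; rewrite /=.
(* Distinctness matters because [height] only ranges over lengths at most [#|Y|]. *)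
have Us : uniq (r :: s) by apply/(@map_uniq _ _ depth)/sorted_uniq/dec; [apply: ltn_trans | move=> ?; rewrite /= ltnn].
have sY : size (r :: s) < #|Y|.+1.
  by rewrite ltnS cardE; apply: uniq_leq_size Us _ => z _; rewrite mem_enum.
apply: (@leq_trans (size (r :: s))); first by rewrite ss ltnS.
rewrite /height (bigmax_sup (Ordinal sY)) //=; apply/existsP.
exists (in_tuple (r :: s)); rewrite /root_to_leaf_path /= rr rs.
by move: sy => /= ->.
Qed.

End ForestOrder.

(* [a y x] reads: y is an ancestor of x. Nothing is said about [a] and [dep]
   outside [A]. *)
Record tree_order (G : sgraph) (A : {set G}) (h : nat) (a : rel G)
    (dep : G -> nat) : Prop := TreeOrder {
  to_refl : {in A, reflexive a};
  to_trans : {in A & &, transitive a};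
  to_chain : {in A & &, forall x y z, a y x -> a z x -> a y z || a z y};
  to_depth : {in A &, forall x y, a y x -> y != x -> dep y < dep x};
  to_height : {in A, forall x, dep x < h};
  to_adj : {in A &, forall x y, adj x y -> a x y || a y x} }.

(** Ancestry and depth are pulled back along the embedding into the closure of an optimal forest. *)
Lemma treedepth_tree_order (G : sgraph) (A : {set G}) (h : nat) :
  treedepth (induced A) <= h -> exists a dep, @tree_order G A h a dep.
Proof.
rewrite /treedepth; case: ex_minnP => m /asboolP[Y [f finj fP] hY] _ mh.
pose g (x : G) : option Y := omap f (insub x).
have gE x : x \in A -> {xA : x \in A & g x = Some (f (Sub x xA))}.
  by move=> xA; exists xA; rewrite /g insubT.
exists (fun x y => if (g x, g y) is (Some u, Some v) then ancestor u v else false).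
exists (fun x => if g x is Some u then depth u else 0).
split.
- by move=> x /gE[xA ->]; apply: connect0.
- move=> y x z /gE[yA ->] /gE[xA ->] /gE[zA ->]; exact: ancestor_trans.
- move=> x y z /gE[xA ->] /gE[yA ->] /gE[zA ->]; exact: ancestor_chain.
- move=> x y /gE[xA ->] /gE[yA ->] yx nyx; apply: ancestor_depth yx _.
  by apply: contraNneq nyx => /finj [->].
- by move=> x /gE[xA ->]; apply: leq_trans (depth_lt_height _) _; rewrite hY.
- by move=> x y /gE[xA ->] /gE[yA ->] /(fP (Sub x xA) (Sub y yA)) /andP[].
Qed.

(** The forest is [par] restricted to [A], acyclic because [mu] decreases; the third hypothesis
    bounds its branches. *)
Lemma treedepth_induced_le (G : sgraph) (A : {set G}) (par : G -> option G)
    (mu : G -> nat) (h : nat) :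
  {in A &, forall x y, par x = Some y -> mu y < mu x} ->
  {in A &, forall x y, adj x y -> par x = Some y \/ par y = Some x} ->
  (forall r s, path (fun x y => par y == Some x) r s -> all [in A] (r :: s) ->
     sorted ltn (map mu (r :: s)) -> size (r :: s) <= h) ->
  treedepth (induced A) <= h.
Proof.
move=> muP adjP pathP.
(* A vertex whose parent lies outside [A] becomes a root. *)
pose pa (x : induced A) : option (induced A) := obind insub (par (val x)).
have paE x y : pa x = Some y -> par (val x) = Some (val y).
  rewrite /pa; case: (par _) => //= z; case: insubP => // u _ <- [->] //.
have paE' (x y : induced A) : par (val x) = Some (val y) -> pa x = Some y.
  by rewrite /pa => -> /=; rewrite valK.
have mupa x y : pa x = Some y -> mu (val y) < mu (val x).
  by move/paE; apply: muP; apply: valP.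
have acyc x : exists n, iter n (obind pa) (Some x) = None.
  elim: {x}_.+1 {-2}x (ltnSn (mu (val x))) => // n IH x xn.
  case E: (pa x) => [y|]; last by exists 1; rewrite /= E.
  have [|m Em] := IH y; first exact: leq_trans (mupa _ _ E) xn.
  by exists m.+1; rewrite iterSr /= E.
pose Y := RForest acyc.
have hY : height Y <= h.
  apply/bigmax_leqP => n /existsP[[s /= /eqP<-]]; case: s => // r s.
  move=> /and3P[_ rs _].
  have rs' : path (fun x y => par y == Some x) (val r) (map val s).
    by apply: homo_path rs => u v /eqP /paE /eqP.
  have := pathP _ _ rs'; rewrite /= size_map; apply.
    by rewrite (valP r) all_map; apply/allP => x _ /=; apply: valP.
  rewrite -map_comp -/(map _ (r :: s)).
  by rewrite path_map; apply: sub_path rs => u v /eqP /mupa.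
apply: leq_trans hY; rewrite /treedepth; case: ex_minnP => m _; apply.
apply/asboolP; exists Y => //; exists id => // x y xy; apply/andP; split.
  by apply: contraTneq xy => ->; rewrite adj_irrefl.
case: (adjP _ _ (valP x) (valP y) xy) => /paE' E; rewrite /ancestor.
  by rewrite orbC connect1 //= E.
by rewrite connect1 //= E.
Qed.

(** * Positions on the path replacing an edge *)

Section PathVertex.
Variables (p : nat) (G : sgraph).
Implicit Type d : sedge G.

Lemma path_vertex_last d : path_vertex p d p.+1 = inl (val d).2.
Proof. by rewrite /path_vertex insubF ?ltnn. Qed.

Lemma path_vertex_mid d (i : 'I_p) : path_vertex p d i.+1 = inr (d, i).
Proof. by rewrite /path_vertex valK. Qed.

Variant path_vertex_spec d : nat -> subdiv_vertex p G -> Prop :=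
  | PathFirst : path_vertex_spec d 0 (inl (val d).1)
  | PathLast : path_vertex_spec d p.+1 (inl (val d).2)
  | PathMid (i : 'I_p) : path_vertex_spec d i.+1 (inr (d, i)).

Lemma path_vertexP d k : k <= p.+1 -> path_vertex_spec d k (path_vertex p d k).
Proof.
case: k => [|k]; first by constructor.
rewrite ltnS leq_eqVlt => /predU1P[->|kp].
  by rewrite path_vertex_last; constructor.
by rewrite -[k]/(val (Ordinal kp)) path_vertex_mid; constructor.
Qed.

Lemma sedge_neq d : (val d).1 != (val d).2.
Proof. by apply: contraTneq (valP d) => ->; rewrite ltnn andbF. Qed.

(* Each edge is listed with only one of its two orientations. *)
Lemma sedge_flip d d' : (val d).1 = (val d').2 -> (val d).2 <> (val d').1.
Proof.
move=> E1 E2; have /andP[_] := valP d; have /andP[_] := valP d'.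
by rewrite E1 E2 => /ltn_trans lt /lt; rewrite ltnn.
Qed.

Lemma path_vertex_inj d k l : k <= p.+1 -> l <= p.+1 ->
  path_vertex p d k = path_vertex p d l -> k = l.
Proof.
move=> /(path_vertexP d)[||i] /(path_vertexP d)[||j] //.
- by case=> E; have := sedge_neq d; rewrite E eqxx.
- by case=> E; have := sedge_neq d; rewrite E eqxx.
- by case=> ->.
Qed.

Lemma path_vertex_adj d k : k < p.+1 ->
  @adj (subdivision p G) (path_vertex p d k) (path_vertex p d k.+1).
Proof.
move=> kp; apply/existsP; exists d; apply/existsP.
by exists (inord k); rewrite inordK // !eqxx.
Qed.

End PathVertex.

(** * Counting the edges whose path lies in a set of small tree-depth *)

Definition edges_in (p : nat) (G : sgraph) (A : {set subdivision p G})
    (W : {set G}) : {set sedge G} :=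
  [set d : sedge G | [&& (val d).1 \in W, (val d).2 \in W
                     & [forall k : 'I_p.+2, path_vertex p d k \in A]]].

Section TopVertex.
Variables (p q : nat) (G : sgraph) (A : {set subdivision p G}).
Variables (a : rel (subdivision p G)) (dep : subdivision p G -> nat).
Hypothesis aP : tree_order A q.+1 a dep.
Implicit Type d : sedge G.

Definition path_in d := forall k, k <= p.+1 -> path_vertex p d k \in A.

Definition path_top d k :=
  k <= p.+1 /\ forall j, j <= p.+1 -> a (path_vertex p d k) (path_vertex p d j).

(** Induction on prefixes. If the new vertex is below its predecessor, the old top stays. Otherwise
    it and the old top are both ancestors of the predecessor, hence comparable, and the higher one
    is the new top. *)
Lemma ex_path_top d : path_in d -> exists k, path_top d k.
Proof.
move=> dA; suff: forall n, n <= p.+1 -> exists k, k <= n /\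
    forall j, j <= n -> a (path_vertex p d k) (path_vertex p d j).
  exact.
elim=> [_|n IH np].
  by exists 0; split=> // j; rewrite leqn0 => /eqP->; apply: (to_refl aP); apply: dA.
have [k [kn kP]] := IH (ltnW np).
have kA := dA k (leq_trans kn (ltnW np)).
have := to_adj aP (dA n (ltnW np)) (dA n.+1 np) (path_vertex_adj d np).
case/orP => [ann|ann].
  exists k; split; first exact: leqW.
  move=> j; rewrite leq_eqVlt => /predU1P[->|]; last exact: kP.
  exact: (to_trans aP (dA n (ltnW np)) kA (dA _ np) (kP n (leqnn n)) ann).
case/orP: (to_chain aP (dA n (ltnW np)) kA (dA _ np) (kP n (leqnn n)) ann) => akn.
  exists k; split; first exact: leqW.
  by move=> j; rewrite leq_eqVlt => /predU1P[->|] //; apply: kP.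
exists n.+1; split=> // j; rewrite leq_eqVlt => /predU1P[->|jn].
  by apply: (to_refl aP); apply: dA.
rewrite ltnS in jn; exact: (to_trans aP kA (dA _ np) (dA j (leq_trans jn (ltnW np))) akn (kP j jn)).
Qed.

(* If the top has depth at least q-1, all other vertices of the path have depth
   q, so no two of them are adjacent and the path is a star centred at the
   top. *)
Lemma path_top_depth d k : q <= p -> path_in d -> path_top d k ->
  dep (path_vertex p d k) < q.-1 \/
  [/\ p = 1, q = 1, k = 1 & dep (path_vertex p d k) = 0].
Proof.
move=> qp dA [kp kP]; set D := dep _.
have ltD j : j <= p.+1 -> j != k -> D < dep (path_vertex p d j).
  move=> jp jk; apply: (to_depth aP); [exact: dA|exact: dA|exact: kP|].
  by apply: contraNneq jk => E; apply/eqP/esym; apply: path_vertex_inj E.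
have leq' j : j <= p.+1 -> dep (path_vertex p d j) <= q.
  by move=> jp; rewrite -ltnS; apply: (to_height aP); apply: dA.
case: (ltnP D q.-1) => [|Dq]; first by left.
have eqk j : j <= p -> j = k \/ j.+1 = k.
  move=> jp; have jp1 := leqW jp; have jp2 : j.+1 <= p.+1 by [].
  have [|jk] := eqVneq j k; first by left.
  have [|jk1] := eqVneq j.+1 k; first by right.
  have ne : path_vertex p d j != path_vertex p d j.+1 by exact: path_vertex_neq.
  have := ltD _ jp1 jk; have := ltD _ jp2 jk1; have := leq' _ jp1; have := leq' _ jp2.
  case/orP: (to_adj aP (dA _ jp1) (dA _ jp2) (path_vertex_adj d jp)) => [l|l].
    by have := to_depth aP (dA _ jp2) (dA _ jp1) l ne; lia.
  by rewrite eq_sym in ne; have := to_depth aP (dA _ jp1) (dA _ jp2) l ne; lia.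
(* The first and last edges of the path both contain position [k], so [p <= 1]; a vertex strictly
   below the top then excludes [q = 0]. *)
have := eqk 0 (leq0n p); have := eqk p (leqnn p).
have k' : exists2 j, j <= p.+1 & j != k.
  by case: (eqVneq 0 k) => [<-|]; [exists 1|exists 0].
by have [j jp jk] := k'; have := ltD _ jp jk; have := leq' _ jp; right; split; lia.
Qed.

Lemma card_edges_in (W : {set G}) : q <= p ->
  2 * #|edges_in A W| <= ((q == 1) + 2 * q.-1) * #|W|.
Proof.
move=> qp.
have Ein d : d \in edges_in A W -> path_in d.
  rewrite inE => /and3P[_ _ /forallP dA] k; rewrite -ltnS => kp.
  exact: dA (Ordinal kp).
have [top topP] : exists top : sedge G -> nat,
    forall d, d \in edges_in A W -> path_top d (top d).
  apply: (@fin_all_exists _ (fun=> nat)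
    (fun d k => d \in edges_in A W -> path_top d k)) => d.
  have [dE|] := boolP (d \in edges_in A W).
    by have [k kP] := ex_path_top (Ein _ dE); exists k.
  by exists 0.
pose t d := path_vertex p d (top d).
have tA d : d \in edges_in A W -> t d \in A.
  by move=> dE; apply: (Ein _ dE); case: (topP _ dE).
(* Tops above a common vertex are comparable, so equal depths make them equal. *)
have t_inj x d d' : d \in edges_in A W -> d' \in edges_in A W -> x \in A ->
    a (t d) x -> a (t d') x -> dep (t d) = dep (t d') -> t d = t d'.
  move=> dE dE' xA dx dx' E; apply/eqP; apply: contraT => ne.
  case/orP: (to_chain aP xA (tA _ dE) (tA _ dE') dx dx') => l.
    by have := to_depth aP (tA _ dE') (tA _ dE) l ne; rewrite E ltnn.
  by rewrite eq_sym in ne; have := to_depth aP (tA _ dE) (tA _ dE') l ne; rewrite E ltnn.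
pose e (d : sedge G) (b : bool) := if b then (val d).1 else (val d).2.
have eW d b : d \in edges_in A W -> e d b \in W.
  by rewrite inE => /and3P[] /[swap]; case: b.
have eE d b : inl (e d b) = path_vertex p d (if b then 0 else p.+1).
  by case: b; rewrite ?path_vertex_last.
have le_e (b : bool) : (if b then 0 else p.+1) <= p.+1 by case: b.
have eA d b : d \in edges_in A W -> inl (e d b) \in A.
  by move=> dE; rewrite eE; apply: Ein (le_e b).
have ae d b : d \in edges_in A W -> a (t d) (inl (e d b)).
  by move=> dE; rewrite eE; have [_] := topP _ dE; apply; apply: le_e.
have depP d (dE : d \in edges_in A W) := path_top_depth qp (Ein _ dE) (topP _ dE).
(* Here the top is the only interior vertex and determines the edge. Both ends are charged, whence
   the 2 on the left. *)
have [/andP[/eqP p1 /eqP q1]|npq] := boolP ((p == 1) && (q == 1)).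
  have top1 d : d \in edges_in A W -> top d = 1 /\ dep (t d) = 0.
    by case/depP => [|[]//]; rewrite q1.
  have -> : 2 * #|edges_in A W| = #|setX (edges_in A W) [set: bool]|.
    by rewrite cardsX cardsT card_bool mulnC.
  rewrite q1 /= mul1n -(@card_in_imset _ _ (fun z => e z.1 z.2)).
    by apply/subset_leq_card/subsetP => _ /imsetP[[d b] /setXP[dE _] ->]; apply: eW.
  move=> [d b] [d' b'] /setXP[/= dE _] /setXP[/= dE' _] E.
  have [d1 d0] := top1 _ dE; have [d1' d0'] := top1 _ dE'.
  have := t_inj _ _ _ dE dE' (eA _ b dE) (ae _ b dE).
  rewrite {1}E d0 d0' => /(_ (ae _ b' dE') erefl); rewrite /t d1 d1'.
  have i0 : 0 < p by rewrite p1.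
  rewrite -[1]/((Ordinal i0).+1) !path_vertex_mid => -[Ed]; rewrite -Ed in E *.
  have := sedge_neq d; move: E; rewrite /e.
  by case: b b' => [] [] //= ->; rewrite eqxx.
have dep_lt d : d \in edges_in A W -> dep (t d) < q.-1.
  by case/depP => [//|[p1 q1]]; rewrite p1 q1 in npq.
apply: (@leq_trans (2 * (#|W| * q.-1))); last by lia.
rewrite leq_mul2l /=.
case Eq : (q.-1) dep_lt => [|r] dep_lt.
  by rewrite muln0 leqn0 cards_eq0; apply/eqP/setP => d; rewrite in_set0; apply/negP => /dep_lt.
(* The first end is charged, unless it is the top itself. *)
pose low d := e d (top d != 0).
have -> : #|W| * r.+1 = #|setX W [set: 'I_r.+1]|.
  by rewrite cardsX cardsT card_ord.
rewrite -(@card_in_imset _ _ (fun d => (low d, inord (dep (t d)) : 'I_r.+1))).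
  by apply/subset_leq_card/subsetP => _ /imsetP[d dE ->]; rewrite inE /= inE andbT eW.
move=> d d' dE dE' [El /(congr1 val) /=]; rewrite !inordK ?dep_lt // => Edep.
have := t_inj _ _ _ dE dE' (eA _ (top d != 0) dE) (ae _ _ dE).
rewrite -/(low d) El => /(_ (ae _ _ dE') Edep).
have [kp _] := topP _ dE; have [kp' _] := topP _ dE'.
(* An interior top identifies its edge; a top that is an end does so together with the charged end,
   which is the other one. *)
move: El; rewrite /t /low /e.
have [||i] := path_vertexP d kp; have [||j] := path_vertexP d' kp' => //= E2 [E1].
- by apply/val_inj/eqP; rewrite -pair_eqE /pair_eq /= E1 E2 !eqxx.
- by case: (sedge_flip E1 E2).
- by case: (sedge_flip E2 E1).
- by apply/val_inj/eqP; rewrite -pair_eqE /pair_eq /= E1 E2 !eqxx.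
- by [].
Qed.

End TopVertex.

(** * Finite counting lemmas *)

Lemma set_card_between (T : finType) (B S : {set T}) (k : nat) :
  B \subset S -> #|B| <= k <= #|S| ->
  exists J : {set T}, [/\ B \subset J, J \subset S & #|J| = k].
Proof.
move=> BS /andP[Bk kS].
have := cards_draws (S :\: B) (k - #|B|).
rewrite cardsDS // => E.
have : 0 < #|[set A : {set T} | A \subset S :\: B & #|A| == k - #|B|]|.
  by rewrite E bin_gt0 leq_sub2r.
case/card_gt0P => A; rewrite inE subsetD => /andP[/andP[AS dAB] /eqP cA].
exists (B :|: A); split; first exact: subsetUl.
  by rewrite subUset BS.
by rewrite cardsU disjoint_setI0 1?disjoint_sym // cards0 subn0 cA subnKC.
Qed.

Lemma leq_card_bigcup (I T : finType) (P : {set I}) (F : I -> {set T}) :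
  #|\bigcup_(i in P) F i| <= \sum_(i in P) #|F i|.
Proof.
elim/big_rec2: _ => [|i n A _ An]; first by rewrite cards0.
by apply: leq_trans (leq_card_setU _ _) _; rewrite leq_add2l.
Qed.

(** Handshake: each ordered pair of adjacent vertices comes from an edge and a boolean choosing its
    orientation. *)
Lemma sum_degrees (G : sgraph) (W : {set G}) :
  \sum_(x in W) #|[set y in W | adj x y]|
    <= 2 * #|[set d : sedge G | ((val d).1 \in W) && ((val d).2 \in W)]|.
Proof.
set E := [set d | _].
under eq_bigr do rewrite -sum1_card.
rewrite pair_big_dep sum1_card.
have -> : 2 * #|E| = #|setX E [set: bool]|.
  by rewrite cardsX cardsT card_bool mulnC.
pose f (z : sedge G * bool) :=
  if z.2 then val z.1 else ((val z.1).2, (val z.1).1).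
apply: leq_trans (leq_imset_card f _).
apply/subset_leq_card/subsetP => -[x y]; rewrite unfold_in inE /= => /and3P[xW yW xy].
have [lt|lt|/val_inj /enum_rank_inj eqxy] := ltngtP (enum_rank x) (enum_rank y).
- have dP : adj (x, y).1 (x, y).2 && (enum_rank (x, y).1 < enum_rank (x, y).2).
    by rewrite xy.
  by apply/imsetP; exists (Sub (x, y) dP, true); rewrite ?inE //= xW yW.
- have dP : adj (y, x).1 (y, x).2 && (enum_rank (y, x).1 < enum_rank (y, x).2).
    by rewrite adj_sym xy.
  by apply/imsetP; exists (Sub (y, x) dP, false); rewrite ?inE //= xW yW.
- by rewrite eqxy adj_irrefl in xy.
Qed.

(** For [q > 0] the weight is at most [q!], and ['C(n, q) * q!] is the falling factorial, at most
    [n ^ q]. *)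
Lemma bin_weight_bound (n q : nat) :
  ('C(n, q) * ((q == 1) + 2 * q.-1)).+1 <= n.+1 ^ q.
Proof.
have ffactE m : n ^_ m <= n ^ m.
  by elim: m => // m IH; rewrite ffactnSr expnSr leq_mul // leq_subr.
have [->|q0] := posnP q; first by rewrite muln0.
apply: (@leq_trans (n ^ q).+1); last by rewrite ltn_exp2r.
rewrite ltnS; apply: leq_trans (ffactE q); rewrite -bin_ffact leq_mul2l.
apply/orP; right; case: q q0 => [|[|[|q]]] // _; rewrite /= add0n !factS.
by have := fact_gt0 q; nia.
Qed.

(** * Lower bound: colouring [G] from a colouring of its subdivision *)

Section LowerBound.
Variables (p N : nat) (G : sgraph) (c : subdivision p G -> 'I_N).
Hypothesis cP : forall I : {set 'I_N}, #|I| <= p.+1 ->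
  treedepth (induced [set x | c x \in I]) <= #|I|.

Let q := minn N.-1 p.
Let K := (q == 1) + 2 * q.-1.

Lemma class_edges (i : 'I_N) (W : {set G}) :
  W \subset [set x | c (inl x) == i] ->
  \sum_(x in W) #|[set y in W | adj x y]| <= 'C(N.-1, q) * K * #|W|.
Proof.
move=> Wi; apply: leq_trans (sum_degrees W) _; set E := [set d | _].
have cardCi : #|~: [set i]| = N.-1 by rewrite cardsC1 card_ord.
pose JJ := [set J : {set 'I_N} | J \subset ~: [set i] & #|J| == q].
pose A (J : {set 'I_N}) := [set x | c x \in i |: J].
have EJ : E \subset \bigcup_(J in JJ) edges_in (A J) W.
  apply/subsetP => d; rewrite inE => /andP[d1 d2].
  pose B := [set c (inr (d, k)) | k : 'I_p] :\ i.
  have Bi : B \subset ~: [set i] by rewrite /B setDE subsetIr.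
  have BN : #|B| <= q.
    rewrite leq_min -cardCi subset_leq_card //=.
    apply: leq_trans (subset_leq_card (subD1set _ _)) _.
    by apply: leq_trans (leq_imset_card _ _) _; rewrite card_ord.
  (* The colours other than [i] on the path are padded to exactly [q], so that the possible sets are
     counted by ['C(N.-1, q)]. *)
  have [|J [BJ Ji Jq]] := set_card_between Bi (k := q).
    by rewrite BN cardCi geq_minl.
  apply/bigcupP; exists J; first by rewrite inE Ji Jq eqxx.
  rewrite inE d1 d2 /=; apply/forallP => k; rewrite inE.
  have [||j] := path_vertexP d (ltn_ord k : k <= p.+1).
  - by have := subsetP Wi _ d1; rewrite inE => /eqP->; rewrite setU11.
  - by have := subsetP Wi _ d2; rewrite inE => /eqP->; rewrite setU11.
  - have [->|ne] := eqVneq (c (inr (d, j))) i; first by rewrite setU11.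
    apply: setU1r; apply: (subsetP BJ); rewrite !inE ne /=.
    exact: imset_f.
have := subset_leq_card EJ; move/leq_trans/(_ (leq_card_bigcup _ _)) => cE.
apply: leq_trans (leq_mul (leqnn 2) cE) _; rewrite big_distrr /=.
have cJJ : #|JJ| = 'C(N.-1, q) by rewrite cards_draws cardCi.
rewrite -mulnA -cJJ -sum_nat_const; apply: leq_sum => J; rewrite inE => /andP[Ji /eqP Jq].
have cJ : #|i |: J| = q.+1.
  by rewrite cardsU1 Jq; case: (boolP (i \in J)) => // /(subsetP Ji); rewrite !inE eqxx.
have := cP (I := i |: J); rewrite cJ ltnS geq_minr => /(_ isT).
by case/treedepth_tree_order => a [dep aP]; apply: (card_edges_in aP); apply: geq_minr.
Qed.

(** If all degrees inside some nonempty [W] exceeded the bound, their sum would contradict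
    [class_edges]. *)
Lemma class_colorable (i : 'I_N) : exists f : {ffun G -> 'I_('C(N.-1, q) * K).+1},
  {in [set x | c (inl x) == i] &, forall x y, adj x y -> f x != f y}.
Proof.
apply: degenerate_colorable => W Wi W0; apply/exists_inP; apply: contraT.
rewrite negb_exists_in => /forall_inP degW.
have := class_edges Wi; rewrite leqNgt => /negP[].
rewrite mulnC; apply: (@leq_trans (#|W| * ('C(N.-1, q) * K).+1)).
  by rewrite ltn_pmul2l // card_gt0.
by rewrite -sum_nat_const; apply: leq_sum => x /degW; rewrite ltnNge.
Qed.

Lemma degeneracy_bound : N * ('C(N.-1, q) * K).+1 <= N ^ p.+1.
Proof.
have [N0|N0] := posnP N; first by rewrite {1}N0.
rewrite expnS leq_mul2l (leq_trans (bin_weight_bound _ _)) ?orbT //.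
by rewrite prednK // leq_pexp2l // geq_minr.
Qed.

(** Each vertex gets the pair of its colour under [c] and its colour within that class. *)
Lemma subdivision_colorable : colorable G (N ^ p.+1).
Proof.
have [f fP] := fin_all_exists class_colorable.
apply: (@colorable_fin _ ('I_N * 'I_('C(N.-1, q) * K).+1)%type
  (fun x => (c (inl x), f (c (inl x)) x))); last first.
  by rewrite card_prod !card_ord degeneracy_bound.
move=> x y xy; apply/eqP => -[cxy]; rewrite cxy; apply/eqP.
by apply: (fP (c (inl y))) => //; rewrite inE ?cxy.
Qed.

End LowerBound.

(** * Upper bound: extending a colouring of [G] to its subdivision *)

Section UpperBound.
Variables (p M : nat) (G : sgraph) (g : G -> 'I_M).
Hypotheses (gP : forall x y, adj x y -> g x != g y) (pM : p.+2 <= M).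

Let free (d : sedge G) : {set 'I_M} := ~: [set g (val d).1; g (val d).2].

(** The default of [nth] is never reached: removing at most two of the [M >= p.+2] colours leaves at
    least [p]. *)
Definition rainbow (v : subdivision p G) : 'I_M :=
  match v with
  | inl x => g x
  | inr (d, i) => nth (g (val d).1) (enum (free d)) i
  end.

Lemma size_free d : p <= size (enum (free d)).
Proof.
rewrite -cardE cardsCs setCK card_ord cards2; move: pM; case: (_ != _); lia.
Qed.

Lemma rainbow_mid d i : rainbow (inr (d, i)) \in free d.
Proof. by rewrite -mem_enum mem_nth // (leq_trans _ (size_free d)). Qed.

Lemma rainbow_inj d k l : k <= p.+1 -> l <= p.+1 ->
  rainbow (path_vertex p d k) = rainbow (path_vertex p d l) -> k = l.
Proof.
have gd : g (val d).1 != g (val d).2 by apply: gP; case/andP: (valP d).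
move=> /(path_vertexP d)[||i] /(path_vertexP d)[||j] // E.
- by rewrite /= in E; rewrite E eqxx in gd.
- by have := rainbow_mid d j; rewrite -E !inE eqxx.
- by rewrite /= in E; rewrite E eqxx in gd.
- by have := rainbow_mid d j; rewrite -E !inE eqxx orbT.
- by have := rainbow_mid d i; rewrite E !inE eqxx.
- by have := rainbow_mid d i; rewrite E !inE eqxx orbT.
- congr _.+1; apply/eqP; move/eqP: E => /=.
  by rewrite nth_uniq ?enum_uniq // (leq_trans _ (size_free d)).
Qed.

Variable I : {set 'I_M}.
Hypothesis Ip : #|I| <= p.+1.

Let A := [set v | rainbow v \in I].

Definition left_full (d : sedge G) (n : nat) : bool :=
  [forall k : 'I_p.+2, (k <= n) ==> (path_vertex p d k \in A)].

(* [i.+1] is the position of [inr (d, i)] on its path; the vertex hangs from the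
   first end of [d] if the path is in [A] up to it, and points towards the
   second end otherwise. *)
Definition arm_parent (v : subdivision p G) : option (subdivision p G) :=
  match v with
  | inl _ => None
  | inr (d, i) => Some (path_vertex p d (if left_full d i.+1 then nat_of_ord i else i.+2))
  end.

(** [p - i] is the distance to the second end, at position [p.+1]; ranks thus grow away from the end
    an arm points to. *)
Definition arm_rank (v : subdivision p G) : nat :=
  match v with
  | inl _ => 0
  | inr (d, i) => if left_full d i.+1 then i.+1 else p - i
  end.

Lemma left_fullS d n : n < p.+1 ->
  left_full d n.+1 = left_full d n && (path_vertex p d n.+1 \in A).
Proof.
move=> np; apply/forallP/andP => [H|[/forallP H H'] k].
  split; last exact: implyP (H (Ordinal (np : n.+1 < p.+2))) (leqnn _).
  by apply/forallP => k; apply/implyP => kn; apply: (implyP (H k)); apply: leqW.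
by apply/implyP; rewrite leq_eqVlt => /predU1P[->//|]; apply/implyP/H.
Qed.

(** A whole path would show [p.+2] distinct colours of [I]. *)
Lemma left_full_last d : ~~ left_full d p.+1.
Proof.
apply/negP => /forallP H.
suff : #|[set: 'I_p.+2]| <= #|I| by rewrite cardsT card_ord ltnNge Ip.
rewrite -(@card_imset _ _ (fun k : 'I_p.+2 => rainbow (path_vertex p d k))).
  apply/subset_leq_card/subsetP => _ /imsetP[k _ ->].
  by have := implyP (H k) (ltn_ord k); rewrite inE.
by move=> k l /rainbow_inj E; apply/val_inj/E; rewrite -ltnS.
Qed.

(** Being [left_full] passes to smaller positions, so an interior parent has the same orientation as
    its child. *)
Lemma arm_parent_rank x y : x \in A -> y \in A ->
  arm_parent x = Some y -> arm_rank y < arm_rank x.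
Proof.
case: x => [//|[d i]] xA yA [E]; move: yA; rewrite -{}E /=.
case: ifP => [L|L] _.
  have := L; rewrite left_fullS; last by rewrite ltnS ltnW.
  have ip : i <= p.+1 by rewrite ltnW // ltnS ltnW.
  by have [||j] //= := path_vertexP d ip => /andP[-> _].
have kp : i.+2 <= p.+1 by rewrite !ltnS.
move Ek : i.+2 kp => k kp; move: Ek.
have [||j] //= := path_vertexP d kp => Ej; rewrite ?subn_gt0 //.
rewrite -Ej left_fullS ?L /=; last by rewrite ltnS.
by case: Ej => <-; rewrite ltn_sub2l.
Qed.

(** If the prefix up to [k.+1] is in [A], then [k.+1] is interior and hangs from [k]. If not, the
    prefix up to [k] already fails, so [k] is interior and hangs from [k.+1]. *)
Lemma arm_parent_adj x y : x \in A -> y \in A -> adj x y ->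
  arm_parent x = Some y \/ arm_parent y = Some x.
Proof.
move=> xA yA /existsP[d /existsP[[k kp] /=]].
wlog : x y xA yA / (x == path_vertex p d k) && (y == path_vertex p d k.+1).
  move=> H /orP[] xy; first by apply: H => //; rewrite xy.
  by apply/or_comm/H => //; rewrite xy.
case/andP=> /eqP Ex /eqP Ey _; subst x y.
case L: (left_full d k.+1); [right|left].
  have kp' : k < p.
    rewrite ltn_neqAle -ltnS kp andbT; apply: contraTneq L => ->.
    exact: left_full_last.
  by rewrite -[k]/(val (Ordinal kp')) path_vertex_mid /= L.
move: L xA (kp); rewrite left_fullS // yA andbT {yA}.
have [||i] := path_vertexP d (ltnW kp) => L xA lt_kp.
- by case/negP: L; apply/forallP => -[[|j] jp].
- by rewrite ltnn in lt_kp.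
- by rewrite /= L.
Qed.

(** Only interior vertices have a parent, on the path of the same edge, so a branch never leaves the
    interior of [d]. *)
Lemma arm_path_edge r s d i :
  path (fun x y => arm_parent y == Some x) r s -> r = inr (d, i) ->
  {in r :: s, forall v, exists j, v = inr (d, j)}.
Proof.
elim: s r i => [|y s IH] r i /=.
  by move=> _ -> v; rewrite inE => /eqP->; exists i.
case/andP=> yr ys Er v; rewrite inE => /predU1P[->|]; first by exists i.
suff [j Ej] : exists j, y = inr (d, j) by apply: IH ys Ej _.
case: y yr {ys} => [//|[e j]] /eqP[].
set k := (X in path_vertex p e X); have kp : k <= p.+1.
  by have jp := ltn_ord j; rewrite /k; case: ifP => _; lia.
by rewrite Er; have [||m] // := path_vertexP e kp => -[-> _]; exists j.
Qed.

(** A branch stays on one rainbow path, its first vertex possibly an end, so its vertices have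
    distinct colours in [I]. *)
Lemma arm_path_size r s :
  path (fun x y => arm_parent y == Some x) r s -> all [in A] (r :: s) ->
  sorted ltn (map arm_rank (r :: s)) -> size (r :: s) <= #|I|.
Proof.
move=> rs rsA srt.
have Urs : uniq (r :: s).
  apply/(@map_uniq _ _ arm_rank)/sorted_uniq/srt; first exact: ltn_trans.
  by move=> n; rewrite /= ltnn.
suff cinj : {in r :: s &, injective rainbow}.
  rewrite -(size_map rainbow) cardE; apply: uniq_leq_size.
    by rewrite map_inj_in_uniq.
  by move=> _ /mapP[v /(allP rsA) vA ->]; rewrite mem_enum; rewrite inE in vA.
case: s rs {rsA srt Urs} => [_|y s /= /andP[]].
  by move=> u v; rewrite !inE => /eqP-> /eqP->.
case: y => [//|[d i]] /eqP[Er] ys.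
have [k kp Ek] : exists2 k, k <= p.+1 & r = path_vertex p d k.
  have ip := ltn_ord i.
  by rewrite -Er; case: ifP => _; [exists i|exists i.+2] => //; lia.
have onP v : v \in [:: r, inr (d, i) & s] ->
    exists2 l, l <= p.+1 & v = path_vertex p d l.
  rewrite inE => /predU1P[->|]; first by exists k.
  case/(arm_path_edge ys erefl) => j ->; exists j.+1; last by rewrite path_vertex_mid.
  by rewrite ltnS ltnW.
by move=> u v /onP[l lp ->] /onP[m mp ->] /rainbow_inj ->.
Qed.

Lemma rainbow_treedepth : treedepth (induced A) <= #|I|.
Proof.
exact: treedepth_induced_le arm_parent_rank arm_parent_adj arm_path_size.
Qed.

End UpperBound.

Local Open Scope ring_scope.

Theorem theorem5 (R : realType) (p : nat) (G : sgraph) :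
  (chromatic_number G)%:R `^ (1 / (p + 1)%:R)
    <= (chi_ (p + 1) (subdivision p G))%:R :> R /\
  (chi_ (p + 1) (subdivision p G) <= maxn (chromatic_number G) (p + 2))%N.
Proof.
rewrite !addnS !addn0; split; rewrite /chi_; case: ex_minnP => N.
  case/existsP => c /forallP cP _.
  have le_chi : (chromatic_number G <= N ^ p.+1)%N.
    apply/chromatic_number_le/(@subdivision_colorable _ _ _ c) => I.
    exact: implyP (cP I).
  (* Writing [N] as a root of its power reduces the claim to monotonicity of that root. *)
  have -> : N%:R = ((N ^ p.+1)%:R : R) `^ (1 / p.+1%:R).
    by rewrite natrX -powR_mulrn ?ler0n // -powRrM div1r mulfV ?powRr1 ?ler0n ?pnatr_eq0.
  by apply: ge0_ler_powR; rewrite ?nnegrE ?divr_ge0 ?ler0n ?ler_nat.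
move=> _; apply; rewrite /chromatic_number.
case: ex_minnP => k /existsP[g /forallP gP] _.
set M := maxn k p.+2.
(* Widening the palette to [M] provides the [p.+2] colours that [rainbow] requires. *)
pose h x : 'I_M := widen_ord (leq_maxl k p.+2) (g x).
apply/existsP; exists [ffun v => rainbow h v]; apply/forallP => I; apply/implyP => Ip.
have hP x y : adj x y -> h x != h y.
  by have /forallP/(_ y)/implyP := gP x.
have -> : [set v | [ffun v : subdivision p G => rainbow h v] v \in I] =
    [set v : subdivision p G | rainbow h v \in I].
  by apply: eq_finset => v; rewrite ffunE.
exact: rainbow_treedepth hP (leq_maxr _ _) _ Ip.
Qed.
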